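(* Let $T:[0,\infty]\to[0,\infty]$ be one of the nine algorithms described in the context, with quadratic field $K$. Then the $T$-orbit of every point $\alpha\in K\cap[0,\infty]$ ends up in a parabolic fixed point: there exists $n\ge0$ such that $T^n(\alpha)$ is a fixed point of $T$ which is fixed by a parabolic element of $\Gamma_T$.
   Context: **Matrices.** $\mathrm{PSL}_2^\pm R$ is the group of $2\times2$ matrices over $R$ with determinant $\pm1$, modulo $\pm1$; it acts on $\mathrm P^1\mathbb R$ by $\begin{bmatrix}a&b\\ c&d\end{bmatrix}*x=\frac{ax+b}{cx+d}$. Let $I_0=[0,\infty]\subset\mathrm P^1\mathbb R$. **The nine algorithms.** Let $\lambda_k=2\cos(\pi/k)$ and $\tau=(1+\sqrt5)/2$. Each algorithm is given by a quadratic field $K$ with integer ring $\mathbb O$ and a list $A_1,\dots,A_r\in\mathrm{PSL}_2^\pm\mathbb O$; the intervals $I_a=A_a*I_0$ cover $I_0$, meet at most in common endpoints, and are numbered in increasing order from $0$ to $\infty$. The map $T:I_0\to I_0$ is $x\mapsto A_a^{-1}*x$ on $I_a$ (a common endpoint of $I_a,I_{a+1}$ is mapped using $A_a^{-1}$; in all nine cases $T$ is continuous). $\Gamma_T^\pm$ is the subgroup of $\mathrm{PSL}_2^\pm\mathbb O$ generated by $A_1,\dots,A_r$, and $\Gamma_T=\Gamma_T^\pm\cap\mathrm{PSL}_2\mathbb R$. A (nonidentity) element of $\Gamma_T$ is parabolic if its trace has absolute value $2$. (I) $(l,m,\infty)\in\{(2,5,\infty),(3,4,\infty),(3,5,\infty),(3,6,\infty)\}$,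 with $K=\mathbb Q(\sqrt5),\mathbb Q(\sqrt2),\mathbb Q(\sqrt5),\mathbb Q(\sqrt3)$ respectively. Let $F=\begin{bmatrix}0&1\\ 1&0\end{bmatrix}$, $Q=\begin{bmatrix}\lambda_l&1\\ -1&0\end{bmatrix}$, $R=\begin{bmatrix}0&1\\ -1&\lambda_m\end{bmatrix}$, $r=(l-1)(m-1)$. For $1\le i<m$, $1\le j<l$ and $a=(i-1)(l-1)+j$, put $A_a=R^iQ^j$ if $a$ is even and $A_a=R^iQ^jF$ if $a$ is odd. (II) $(l,\infty,\infty)$ with $l=4,5,6$, $K=\mathbb Q(\sqrt2),\mathbb Q(\sqrt5),\mathbb Q(\sqrt3)$ and $\beta=2+\sqrt2,\,2+\tau,\,2+\sqrt3$ respectively. Let $J=\begin{bmatrix}-1&0\\ 0&1\end{bmatrix}$, $P=\begin{bmatrix}-1&1\\ 0&1\end{bmatrix}$, $M=\begin{bmatrix}1&0\\ \beta&-1\end{bmatrix}$, $r=2l-1$. For $0\le q\le l-2$ put $A_{1+2q}=(MP)^qMJ$, $A_{2+2q}=(MP)^{q+1}J$; and $A_{2l-1}=(MP)^{l-1}MJ=\begin{bmatrix}1&1\\ 0&1\end{bmatrix}$. (III) $(4,m,\infty)$ with $m=6$, $K=\mathbb Q(\sqrt6)$, or $m=12$, $K=\mathbb Q(\sqrt3)$. Write $P_x=\begin{bmatrix}-1&x\\ 0&1\end{bmatrix}$, $M_x=\begin{bmatrix}1&0\\ x&-1\end{bmatrix}$. For $m=6$: $\alpha=3-\sqrt6$,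 $\beta=3+\sqrt6$, $\gamma=2-\sqrt6$, $\delta=-2-\sqrt6$. For $m=12$: $\alpha=1$, $\beta=2+\sqrt3$, $\gamma=1-\sqrt3$, $\delta=-1-\sqrt3$. Let $U_1=P_\gamma$, $U_2=P_\gamma M_\delta$, $U_3=P_\gamma M_\delta P_\gamma$; and, for $1\le j\le m-1$, $V_j=(M_\beta P_\alpha)^{j/2}$ if $j$ is even, $V_j=(M_\beta P_\alpha)^{(j-1)/2}M_\beta$ if $j$ is odd. Let $r=3(m-1)$, and put $(A_{3j-2},A_{3j-1},A_{3j})=(V_jU_3,V_jU_2,V_jU_1)$ if $j$ is odd, and $=(V_jU_1,V_jU_2,V_jU_3)$ if $j$ is even. *)

(* Defs.v *)
From HB Require Import structures.
From mathcomp Require Import all_boot all_order all_algebra.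
From mathcomp Require Import all_classical all_reals all_analysis.

Set Implicit Arguments.
Unset Strict Implicit.
Unset Printing Implicit Defensive.

Import Order.TTheory GRing.Theory Num.Theory.
Local Open Scope classical_set_scope.
Local Open Scope ring_scope.

(* The nine algorithms, named by their (l, m, oo); in the second group m = oo. *)
Variant algorithm : Type :=
  | Alg_2_5 | Alg_3_4 | Alg_3_5 | Alg_3_6
  | Alg_4_oo | Alg_5_oo | Alg_6_oo
  | Alg_4_6 | Alg_4_12.

(* The quadratic field of t is K = Q(sqrt (radicand t)). *)
Definition radicand (t : algorithm) : nat :=
  match t with
  | Alg_2_5 => 5 | Alg_3_4 => 2 | Alg_3_5 => 5 | Alg_3_6 => 3
  | Alg_4_oo => 2 | Alg_5_oo => 5 | Alg_6_oo => 3
  | Alg_4_6 => 6 | Alg_4_12 => 3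
  end.

Section Algorithms.
Variable R : realType.

(* P^1(R), with [None] the point at infinity. *)
Definition P1 : Type := option R.

Definition I0 : set P1 := [set x | if x is Some y then 0 <= y else True].

Definition quadratic_field (d : nat) : set R :=
  [set x | exists a b : rat, x = ratr a + ratr b * Num.sqrt d%:R].

Definition P1_field (K : set R) : set P1 := (Some @` K) `|` [set None].

Definition mx2 (a b c d : R) : 'M[R]_2 :=
  \matrix_(i, j) if i == 0 then (if j == 0 then a else b)
                 else (if j == 0 then c else d).

(* Only meaningful for invertible matrices; A and - A act in the same way. *)
Definition mobius (A : 'M[R]_2) (x : P1) : P1 :=
  match x with
  | Some y =>
      if A 1 0 * y + A 1 1 == 0 then None
      else Some ((A 0 0 * y + A 0 1) / (A 1 0 * y + A 1 1))
  | None => if A 1 0 == 0 then None else Some (A 0 0 / A 1 0)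
  end.

Definition lambda (k : nat) : R := 2 * cos (pi / k%:R).

Definition tau : R := (1 + Num.sqrt 5) / 2.

(* A_1, ..., A_r in this order: the index i is the outer one in the
   enumeration, so that (i, j) comes at position a = (i - 1)(l - 1) + j. *)
Definition branches_I (l m : nat) : seq 'M[R]_2 :=
  let F := mx2 0 1 1 0 in
  let Q := mx2 (lambda l) 1 (-1) 0 in
  let S := mx2 0 1 (-1) (lambda m) in
  [seq (if odd ((i - 1) * (l - 1) + j)%N then S ^+ i * Q ^+ j * F
        else S ^+ i * Q ^+ j) | i <- iota 1 (m - 1), j <- iota 1 (l - 1)].

Definition branches_II (l : nat) (beta : R) : seq 'M[R]_2 :=
  let J := mx2 (-1) 0 0 1 in
  let P := mx2 (-1) 1 0 1 in
  let M := mx2 1 0 beta (-1) in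
  flatten [seq [:: (M * P) ^+ q * M * J; (M * P) ^+ q.+1 * J]
          | q <- iota 0 (l - 1)]
  ++ [:: (M * P) ^+ (l - 1) * M * J].

Definition branches_III (m : nat) (alpha beta gamma delta : R) :
    seq 'M[R]_2 :=
  let P x := mx2 (-1) x 0 1 in
  let M x := mx2 1 0 x (-1) in
  let U1 := P gamma in
  let U2 := P gamma * M delta in
  let U3 := P gamma * M delta * P gamma in
  let V j := if odd j then (M beta * P alpha) ^+ ((j - 1) %/ 2) * M beta
             else (M beta * P alpha) ^+ (j %/ 2) in
  flatten [seq (if odd j then [:: V j * U3; V j * U2; V j * U1]
                else [:: V j * U1; V j * U2; V j * U3])
          | j <- iota 1 (m - 1)].

Definition branches (t : algorithm) : seq 'M[R]_2 :=
  match t with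
  | Alg_2_5 => branches_I 2 5
  | Alg_3_4 => branches_I 3 4
  | Alg_3_5 => branches_I 3 5
  | Alg_3_6 => branches_I 3 6
  | Alg_4_oo => branches_II 4 (2 + Num.sqrt 2)
  | Alg_5_oo => branches_II 5 (2 + tau)
  | Alg_6_oo => branches_II 6 (2 + Num.sqrt 3)
  | Alg_4_6 => branches_III 6 (3 - Num.sqrt 6) (3 + Num.sqrt 6)
                              (2 - Num.sqrt 6) (- 2 - Num.sqrt 6)
  | Alg_4_12 => branches_III 12 1 (2 + Num.sqrt 3)
                                (1 - Num.sqrt 3) (- 1 - Num.sqrt 3)
  end.

(* T x = A_a^-1 * x for the least a with x in I_a = A_a * I0.  As the I_a are
   numbered in increasing order, a common endpoint of I_a and I_(a+1) is mapped
   using A_a.  The default value 1 is only reached outside the union of the I_a,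
   which is I0. *)
Definition T (t : algorithm) (x : P1) : P1 :=
  let As := branches t in
  mobius (nth 1 As (find (fun A => x \in mobius A @` I0) As))^-1 x.

(* Subgroups of PSL_2^{+-} R are given by their preimages in the group of
   matrices of determinant 1 or -1, hence the closure under opposite. *)
Inductive Gamma_pm (t : algorithm) : 'M[R]_2 -> Prop :=
  | Gamma_pm_gen A : A \in branches t -> Gamma_pm t A
  | Gamma_pm_1 : Gamma_pm t 1
  | Gamma_pm_M A B : Gamma_pm t A -> Gamma_pm t B -> Gamma_pm t (A * B)
  | Gamma_pm_V A : Gamma_pm t A -> Gamma_pm t A^-1
  | Gamma_pm_N A : Gamma_pm t A -> Gamma_pm t (- A).

Definition Gamma (t : algorithm) : set 'M[R]_2 :=
  [set A | Gamma_pm t A /\ \det A = 1].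

(* A is the identity of PSL_2 R iff A = 1 or A = -1. *)
Definition parabolic (A : 'M[R]_2) : Prop :=
  [/\ A <> 1, A <> -1 & `|\tr A| = 2].

End Algorithms.

Arguments I0 {R}.
Arguments quadratic_field R d : clear implicits.

(* Main.v *)
From HB Require Import structures.
Require Import Defs.
From mathcomp Require Import all_boot all_order all_algebra.
From mathcomp Require Import all_classical all_reals all_analysis.
From mathcomp Require Import ring lra zify.

Set Implicit Arguments.
Unset Strict Implicit.
Unset Printing Implicit Defensive.

Import Order.TTheory GRing.Theory Num.Theory.

Local Open Scope classical_set_scope.
Local Open Scope ring_scope.

(** Write a point of K as x/y with x, y integers of K, and let ' be the
    conjugation.  Up to sign every branch matrix (a b; c e) has nonnegative
    entries, and for a suitable s > 0 in K it satisfies |a'| <= a, |e'| <= e,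
    s |b'| <= |s'| b and |s'| |c'| <= s c, not all with equality.  Since T acts
    on (x, y) by the inverse of such a matrix, pairing the inequalities with
    (|y'|, |x'|) shows that phi = |s' y'| x + s |x'| y strictly decreases along
    the orbit as long as both coordinates are nonzero.  With h = s' x y' one
    has phi = |h| + |h'|, so phi^2 is a natural number, and the orbit must reach
    0 or oo.  There T is read off from the branches: oo is fixed by a unipotent
    branch, and 0 is either fixed by a unipotent branch or sent to oo. *)

(** * Computing with integers of the quadratic field *)

(* [(a, b)] stands for [a + b omega], where [omega] is [tau] if [d = 5] and
   [sqrt d] otherwise. *)
Definition zq : Type := (int * int)%type.

Definition tr_omega (d : nat) : int := (d == 5)%N%:Z.
(** Minus the norm of [omega], so that [omega^2 = tr_omega omega + nm_omega]. *)
Definition nm_omega (d : nat) : int := if d == 5%N then 1 else d%:Z.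

Definition zint (n : int) : zq := (n, 0).
Definition zadd (x y : zq) : zq := (x.1 + y.1, x.2 + y.2).
Definition zopp (x : zq) : zq := (- x.1, - x.2).
Definition zmul (d : nat) (x y : zq) : zq :=
  (x.1 * y.1 + nm_omega d * (x.2 * y.2),
   x.1 * y.2 + x.2 * y.1 + tr_omega d * (x.2 * y.2)).
Definition zconj (d : nat) (x : zq) : zq := (x.1 + tr_omega d * x.2, - x.2).
Definition zsqrt (d : nat) : zq := if d == 5%N then (-1, 2%:Z) else (0, 1).

(* Up to a factor 1 or 2, [a + b omega] is [u + w sqrt d]; when the signs of [u]
   and [w] differ, compare [u ^ 2] with [d w ^ 2]. *)
Definition zgt0 (d : nat) (x : zq) : bool :=
  let u := if d == 5%N then 2%:Z * x.1 + x.2 else x.1 in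
  let w := x.2 in
  [|| [&& 0 <= u, 0 <= w & (0 < u) || (0 < w)],
      (0 < u) && (d%:Z * (w * w) < u * u)
    | (0 < w) && (u * u < d%:Z * (w * w))].
Definition zge0 (d : nat) (x : zq) : bool := (x == zint 0) || zgt0 d x.
Definition zabs_le (d : nat) (x y : zq) : bool :=
  zge0 d (zadd y x) && zge0 d (zadd y (zopp x)).
Definition zabs_lt (d : nat) (x y : zq) : bool :=
  zgt0 d (zadd y x) && zgt0 d (zadd y (zopp x)).

(** * Exact matrices and branch lists *)

Record zmx := ZMx { za : zq; zb : zq; zc : zq; ze : zq }.

(** The bijection with quadruples gives [zmx] a decidable equality, so that membership in a list of
    branches makes sense. *)
Definition prod_of_zmx (A : zmx) : zq * zq * zq * zq :=
  (za A, zb A, zc A, ze A).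
Definition zmx_of_prod (x : zq * zq * zq * zq) : zmx :=
  let: (a, b, c, e) := x in ZMx a b c e.
Lemma prod_of_zmxK : cancel prod_of_zmx zmx_of_prod. Proof. by case. Qed.
HB.instance Definition _ := Equality.copy zmx (can_type prod_of_zmxK).

Definition zmx1 : zmx := ZMx (zint 1) (zint 0) (zint 0) (zint 1).
Definition zmxopp (A : zmx) : zmx :=
  ZMx (zopp (za A)) (zopp (zb A)) (zopp (zc A)) (zopp (ze A)).
Definition zmxmul (d : nat) (A B : zmx) : zmx :=
  let m := zmul d in
  ZMx (zadd (m (za A) (za B)) (m (zb A) (zc B)))
      (zadd (m (za A) (zb B)) (m (zb A) (ze B)))
      (zadd (m (zc A) (za B)) (m (ze A) (zc B)))
      (zadd (m (zc A) (zb B)) (m (ze A) (ze B))).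
Definition zmxexp (d : nat) (A : zmx) (n : nat) : zmx := iter n (zmxmul d A) zmx1.
Definition zdet (d : nat) (A : zmx) : zq :=
  zadd (zmul d (za A) (ze A)) (zopp (zmul d (zb A) (zc A))).

(** This list and the next two copy those of the theorem in integer coordinates, so that the
    properties of the branches can be checked by [vm_compute]. *)
Definition zbranches_I (d l m : nat) (ll lm : zq) : seq zmx :=
  let o := zint 1 in let z := zint 0 in
  let F := ZMx z o o z in
  let Q := ZMx ll o (zopp o) z in
  let S := ZMx z o (zopp o) lm in
  let M := zmxmul d in let X := zmxexp d in
  [seq (if odd ((i - 1) * (l - 1) + j)%N then M (M (X S i) (X Q j)) F
        else M (X S i) (X Q j)) | i <- iota 1 (m - 1), j <- iota 1 (l - 1)].

Definition zbranches_II (d l : nat) (beta : zq) : seq zmx :=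
  let o := zint 1 in let z := zint 0 in
  let J := ZMx (zopp o) z z o in
  let P := ZMx (zopp o) o z o in
  let N := ZMx o z beta (zopp o) in
  let M := zmxmul d in let X := zmxexp d in
  flatten [seq [:: M (M (X (M N P) q) N) J; M (X (M N P) q.+1) J]
          | q <- iota 0 (l - 1)]
  ++ [:: M (M (X (M N P) (l - 1)%N) N) J].

Definition zbranches_III (d m : nat) (alpha beta gamma delta : zq) : seq zmx :=
  let o := zint 1 in let z := zint 0 in
  let P x := ZMx (zopp o) x z o in
  let N x := ZMx o z x (zopp o) in
  let M := zmxmul d in let X := zmxexp d in
  let U1 := P gamma in
  let U2 := M (P gamma) (N delta) in
  let U3 := M (M (P gamma) (N delta)) (P gamma) in
  let V j := if odd j then M (X (M (N beta) (P alpha)) ((j - 1) %/ 2)%N) (N beta)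
             else X (M (N beta) (P alpha)) (j %/ 2)%N in
  flatten [seq (if odd j then [:: M (V j) U3; M (V j) U2; M (V j) U1]
                else [:: M (V j) U1; M (V j) U2; M (V j) U3])
          | j <- iota 1 (m - 1)].

(** The values of [lambda] are entered in closed form: 0 for [k = 2], 1 for [k = 3], and [omega],
    that is [(0, 1)], for [k = 4, 5, 6]. *)
Definition zbranches (t : algorithm) : seq zmx :=
  let d := radicand t in let i n := zint n in
  match t with
  | Alg_2_5 => zbranches_I d 2 5 (i 0) (0, 1)
  | Alg_3_4 => zbranches_I d 3 4 (i 1) (0, 1)
  | Alg_3_5 => zbranches_I d 3 5 (i 1) (0, 1)
  | Alg_3_6 => zbranches_I d 3 6 (i 1) (0, 1)
  | Alg_4_oo => zbranches_II d 4 (2%:Z, 1)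
  | Alg_5_oo => zbranches_II d 5 (2%:Z, 1)
  | Alg_6_oo => zbranches_II d 6 (2%:Z, 1)
  | Alg_4_6 => zbranches_III d 6 (3%:Z, -1) (3%:Z, 1) (2%:Z, -1) (- 2%:Z, -1)
  | Alg_4_12 => zbranches_III d 12 (1, 0) (2%:Z, 1) (1, -1) (-1, -1)
  end.

(* Chooses the representative of a class in PSL_2^{+-} with nonnegative
   entries. *)
Definition znormal (d : nat) (A : zmx) : zmx :=
  if zgt0 d (ze A) then A else zmxopp A.

Definition nbranches (t : algorithm) : seq zmx :=
  map (znormal (radicand t)) (zbranches t).

(* The element s of the header: |s'|/s has to lie between the maximum of |b'|/b
   and the minimum of c/|c'| over all branches.  For [Alg_4_6] and [Alg_4_12]
   these two bounds coincide; s = 1 fails for the second group of algorithms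
   because of the branch [x + 1]. *)
Definition weight (t : algorithm) : zq :=
  match t with
  | Alg_2_5 | Alg_3_4 | Alg_3_5 | Alg_3_6 => zint 1
  | Alg_4_oo => (3%:Z, -1)
  | Alg_5_oo => (7%:Z, - 2%:Z)
  | Alg_6_oo => (3%:Z, -1)
  | Alg_4_6 => (- 2%:Z, 1)
  | Alg_4_12 => (-1, 1)
  end.

Definition abs_conj_weight (t : algorithm) : zq :=
  let s := zconj (radicand t) (weight t) in
  if zgt0 (radicand t) s then s else zopp s.

(** * Decidable conditions on the branches *)

Definition contracting (t : algorithm) (A : zmx) : bool :=
  let d := radicand t in
  let s := weight t in let s' := abs_conj_weight t in
  let: ZMx a b c e := A in
  let a' := zconj d a in let e' := zconj d e in
  let b' := zmul d s (zconj d b) in let b0 := zmul d s' b in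
  let c' := zmul d s' (zconj d c) in let c0 := zmul d s c in
  [&& zabs_le d a' a, zabs_le d e' e, zabs_le d b' b0, zabs_le d c' c0
    & [|| zabs_lt d a' a, zabs_lt d e' e, zabs_lt d b' b0 | zabs_lt d c' c0]].

(** As [e > 0], a zero [b] means that the branch fixes 0, and a zero [c] that it fixes oo. The two
    implications make such a branch a nontrivial unipotent, which is where the parabolic elements
    come from. *)
Definition admissible (t : algorithm) (A : zmx) : bool :=
  let d := radicand t in
  let: ZMx a b c e := A in
  [&& zge0 d a, zge0 d b, zge0 d c, zgt0 d e,
      (zdet d A == zint 1) || (zdet d A == zint (-1)),
      (b == zint 0) ==> [&& a == zint 1, e == zint 1 & zgt0 d c],
      (c == zint 0) ==> [&& a == zint 1, e == zint 1 & zgt0 d b]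
    & contracting t A].

(* The endpoints of [A * I0] are its columns in homogeneous coordinates; the
   sign of the determinant tells which one is the smaller. *)
Definition low_end (d : nat) (A : zmx) : zq * zq :=
  if zdet d A == zint 1 then (zb A, ze A) else (za A, zc A).
Definition high_end (d : nat) (A : zmx) : zq * zq :=
  if zdet d A == zint 1 then (za A, zc A) else (zb A, ze A).

(** Endpoints are compared as vectors, not up to a scalar: after the sign normalisation,
    neighbouring intervals share them exactly. The vectors [(0, 1)] and [(1, 0)] are the points 0
    and oo. *)
Definition tiling (d : nat) (As : seq zmx) : bool :=
  if As is A :: As' then
    [&& low_end d A == (zint 0, zint 1),
        path (fun A B => high_end d A == low_end d B) A As'
      & high_end d (last A As') == (zint 1, zint 0)]
  else false.

Lemma nbranches_admissible (t : algorithm) : all (admissible t) (nbranches t).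
Proof. by case: t; vm_compute. Qed.

Lemma nbranches_tiling (t : algorithm) : tiling (radicand t) (nbranches t).
Proof. by case: t; vm_compute. Qed.

Lemma weight_gt0 (t : algorithm) : zgt0 (radicand t) (weight t).
Proof. by case: t; vm_compute. Qed.

Lemma abs_conj_weight_gt0 (t : algorithm) :
  zgt0 (radicand t) (abs_conj_weight t).
Proof. by case: t; vm_compute. Qed.

(** * The two real embeddings *)

Section Evaluation.
Variables (R : realType) (d : nat).
Hypothesis d_rad : d \in [:: 2; 3; 5; 6]%N.

Definition omega : R := if d == 5%N then tau R else Num.sqrt d%:R.
Definition omega_conj : R :=
  if d == 5%N then 1 - tau R else - Num.sqrt d%:R.

Definition zval (w : R) (x : zq) : R := x.1%:~R + x.2%:~R * w.

(** Being a root of the minimal polynomial of [omega] is all that multiplicativity of [zval w]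
    requires, so both embeddings are treated at once. *)
Definition zroot (w : R) : Prop :=
  w * w = (tr_omega d)%:~R * w + (nm_omega d)%:~R.

Lemma sqrt5_sqr : Num.sqrt 5 * Num.sqrt 5 = 5 :> R.
Proof. by rewrite -expr2 sqr_sqrtr. Qed.

Lemma omega_root : zroot omega.
Proof.
rewrite /zroot /omega /tr_omega /nm_omega; case: eqP => _ /=.
  by rewrite /tau; have := sqrt5_sqr; set r := Num.sqrt _ => h; nra.
by rewrite -expr2 sqr_sqrtr // mul0r add0r.
Qed.

Lemma omega_conj_root : zroot omega_conj.
Proof.
rewrite /zroot /omega_conj /tr_omega /nm_omega; case: eqP => _ /=.
  by rewrite /tau; have := sqrt5_sqr; set r := Num.sqrt _ => h; nra.
by rewrite mulrNN -expr2 sqr_sqrtr // mul0r add0r.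
Qed.

Lemma omegaD : omega + omega_conj = (tr_omega d)%:~R.
Proof. by rewrite /omega /omega_conj /tr_omega; case: eqP => _ /=; ring. Qed.

Lemma zval_int w n : zval w (zint n) = n%:~R.
Proof. by rewrite /zval /= mul0r addr0. Qed.

Lemma zvalD w x y : zval w (zadd x y) = zval w x + zval w y.
Proof. by rewrite /zval /= !intrD; ring. Qed.

Lemma zvalN w x : zval w (zopp x) = - zval w x.
Proof. by rewrite /zval /= !mulrNz; ring. Qed.

Lemma zvalM w x y : zroot w -> zval w (zmul d x y) = zval w x * zval w y.
Proof.
rewrite /zval /= => h; rewrite !(intrD, intrM).
transitivity (x.1%:~R * y.1%:~R + (x.1%:~R * y.2%:~R + x.2%:~R * y.1%:~R) * w
   + x.2%:~R * y.2%:~R * (w * w)); first by rewrite h; ring.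
by ring.
Qed.

Lemma zval_conj x : zval omega (zconj d x) = zval omega_conj x.
Proof.
by rewrite /zval /= intrD intrM mulrNz -omegaD; ring.
Qed.

Lemma zval_conjK x : zval omega_conj (zconj d x) = zval omega x.
Proof.
by rewrite /zval /= intrD intrM mulrNz -omegaD; ring.
Qed.

Lemma zval_sqrt : zval omega (zsqrt d) = Num.sqrt d%:R.
Proof.
rewrite /zval /zsqrt /omega; case: eqP => [->|_] /=; last by ring.
by rewrite /tau; field.
Qed.

(** Clears the denominator of [tau], so that sign and vanishing are decided on numbers
    [u + w sqrt d] with integers [u] and [w]. *)
Lemma zval_double x :
  zval omega x * (if d == 5%N then 2 else 1) =
  (if d == 5%N then 2%:Z * x.1 + x.2 else x.1)%:~R + x.2%:~R * Num.sqrt d%:R.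
Proof.
rewrite /zval /omega; case: eqP => [->|_] /=; last by ring.
by rewrite intrD intrM /tau; field.
Qed.

Lemma rad_gt0 : 0 < d%:R :> R.
Proof. by rewrite ltr0n; move: d_rad; case: d. Qed.

Lemma zgt0P x : zgt0 d x -> 0 < zval omega x.
Proof.
rewrite /zgt0; have := zval_double x.
set c := (if d == 5%N then 2 else 1 : R); set u := (if _ then _ else _ : int).
move=> e h; have c0 : 0 < c by rewrite /c; case: ifP.
rewrite -(pmulr_lgt0 _ c0) e {e c0}.
have := rad_gt0; rewrite -sqrtr_gt0 => r0.
have := sqr_sqrtr (ltW rad_gt0); rewrite expr2; set r := Num.sqrt _ in r0 *.
move=> rr; case/or3P: h.
- case/and3P => u0 w0; rewrite -(ler0z R) in u0; rewrite -(ler0z R) in w0.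
  by case/orP; rewrite -(ltr0z R) => h; nra.
- case/andP; rewrite -(ltr0z R) -(ltr_int R) !intrM => u0.
  rewrite -[d%:Z%:~R]/(d%:R) -rr => h.
  have [w0|w0] := lerP 0 (x.2%:~R : R); first by nra.
  (* Multiplying by the conjugate [u - w r], positive as [w < 0 < u], leaves [u^2 - d w^2]. The last
     case is symmetric. *)
  have p : 0 < u%:~R - x.2%:~R * r by nra.
  by rewrite -(pmulr_lgt0 _ p); lra.
- case/andP; rewrite -(ltr0z R) -(ltr_int R) !intrM => u0.
  rewrite -[d%:Z%:~R]/(d%:R) -rr => h.
  have [w0|w0] := lerP 0 (u%:~R : R); first by nra.
  have p : 0 < x.2%:~R * r - u%:~R by nra.
  by rewrite -(pmulr_lgt0 _ p); lra.
Qed.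

Lemma zge0P x : zge0 d x -> 0 <= zval omega x.
Proof. by case/orP => [/eqP->|/zgt0P/ltW//]; rewrite zval_int. Qed.

Lemma zabs_leP x y :
  zabs_le d x y -> `|zval omega x| <= zval omega y.
Proof.
by case/andP => /zge0P + /zge0P; rewrite !zvalD zvalN ler_norml => h g; lra.
Qed.

Lemma zabs_ltP x y :
  zabs_lt d x y -> `|zval omega x| < zval omega y.
Proof.
by case/andP => /zgt0P + /zgt0P; rewrite !zvalD zvalN ltr_norml => h g; lra.
Qed.

(** Some prime divides [d] exactly once (2 when [d = 6]); for nonzero [n] its valuation would be
    even on the left and odd on the right. *)
Lemma rad_sqr_free (m n : nat) : (m * m = d * (n * n))%N -> n = 0%N.
Proof.
move=> e; apply/eqP/contraT; rewrite -lt0n => n0.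
have d0 : (0 < d)%N by move: d_rad; case: d.
have m0 : (0 < m)%N.
  rewrite lt0n; apply/negP => /eqP m0; move: e; rewrite m0 => /eqP.
  by rewrite eq_sym !muln_eq0 !eqn0Ngt d0 n0.
have: exists p, logn p d = 1%N.
  move: d_rad; rewrite !inE => /or4P[] /eqP->.
  by exists 2%N. by exists 3%N. by exists 5%N. by exists 2%N.
case=> p pd; have := congr1 (logn p) e.
rewrite !lognM ?muln_gt0 ?n0 // pd => /(congr1 odd).
by rewrite !oddD !addbb.
Qed.

Lemma sqrt_rad_irrational (u w : int) :
  u%:~R + w%:~R * Num.sqrt d%:R = 0 :> R -> u = 0 /\ w = 0.
Proof.
move=> e.
have e2 : (u * u)%:~R = (d%:Z * (w * w))%:~R :> R.
  rewrite !intrM -[d%:Z%:~R]/(d%:R) -[d%:R](sqr_sqrtr (ltW rad_gt0)) expr2.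
  by have -> : u%:~R = - (w%:~R * Num.sqrt d%:R) :> R by [lra]; ring.
move/intr_inj: e2 => /(congr1 absz); rewrite !abszM absz_nat => /rad_sqr_free.
move/eqP; rewrite absz_eq0 => /eqP w0; split => //.
by move/eqP: e; rewrite w0 mul0r addr0 intr_eq0 => /eqP.
Qed.

Lemma zval_eq0 x : (zval omega x == 0) = (x == zint 0).
Proof.
apply/eqP/eqP => [e|->]; last by rewrite zval_int.
have := zval_double x; rewrite e mul0r => /esym/sqrt_rad_irrational.
case: x {e} => a b /= [+ b0]; rewrite b0.
by case: eqP => _ h; rewrite /zint; congr (_, _); lia.
Qed.

Lemma zval_conj_eq0 x : (zval omega_conj x == 0) = (x == zint 0).
Proof.
rewrite -zval_conj zval_eq0; case: x => a b; rewrite /zconj /zint /=.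
apply/eqP/eqP => [[] e /eqP|[-> ->]]; last by rewrite mulr0 addr0 oppr0.
by rewrite oppr_eq0 => /eqP b0; move: e; rewrite b0 mulr0 addr0 => ->.
Qed.

(* [(|x| + |x'|)^2 = (x + x')^2 - 2 x x' + 2 |x x'|] is an integer. *)
Lemma zval_height_nat x :
  exists n : nat, (`|zval omega x| + `|zval omega_conj x|) ^+ 2 = n%:R.
Proof.
pose t : int := x.1 + x.1 + tr_omega d * x.2.
pose m : int := x.1 * x.1 + tr_omega d * (x.1 * x.2) - nm_omega d * (x.2 * x.2).
have et : zval omega x + zval omega_conj x = t%:~R.
  by rewrite /zval /t !(intrD, intrM) -omegaD; ring.
have en : zval omega x * zval omega_conj x = m%:~R.
  rewrite /zval /m !(intrD, intrM, mulrNz) -omegaD.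
  have -> : omega_conj = (tr_omega d)%:~R - omega by rewrite -omegaD; ring.
  have := omega_root; rewrite /zroot => h.
  have -> : (nm_omega d)%:~R = omega * omega - (tr_omega d)%:~R * omega.
    by rewrite h; ring.
  ring.
move: t m et en => t m et en.
have e : (`|zval omega x| + `|zval omega_conj x|) ^+ 2
         = (t * t - 2%:Z * m + 2%:Z * `|m|)%:~R.
  rewrite !(intrD, intrM, mulrNz) intr_norm -et -en normrM.
  have := real_normK (num_real (zval omega x)).
  have := real_normK (num_real (zval omega_conj x)).
  by rewrite !expr2 => h1 h2; lra.
have : 0 <= t * t - 2%:Z * m + 2%:Z * `|m|.
  by rewrite -(ler0z R) -e sqr_ge0.
by move: e; case: (_ - _ + _ : int) => // n e _; exists n.
Qed.

End Evaluation.

(** * The branches over K *)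

Lemma radicandP (t : algorithm) : radicand t \in [:: 2; 3; 5; 6]%N.
Proof. by case: t. Qed.

Section Matrices.
Variable R : realType.

Lemma mx2_mul (a b c e a' b' c' e' : R) :
  mx2 a b c e * mx2 a' b' c' e' =
  mx2 (a * a' + b * c') (a * b' + b * e') (c * a' + e * c') (c * b' + e * e').
Proof.
apply/matrixP => i j; rewrite !mxE !big_ord_recl big_ord0 addr0 !mxE /=.
by case: i => [[|[|//]] hi]; case: j => [[|[|//]] hj].
Qed.

Lemma mx2_1 : mx2 1 0 0 1 = 1 :> 'M[R]_2.
Proof.
apply/matrixP => i j; rewrite !mxE.
by case: i => [[|[|//]] hi]; case: j => [[|[|//]] hj].
Qed.

Lemma mx2N (a b c e : R) : - mx2 a b c e = mx2 (- a) (- b) (- c) (- e).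
Proof.
apply/matrixP => i j; rewrite !mxE.
by case: i => [[|[|//]] hi]; case: j => [[|[|//]] hj].
Qed.

Lemma tr_mx2 (a b c e : R) : \tr (mx2 a b c e) = a + e.
Proof. by rewrite /mxtrace !big_ord_recl big_ord0 addr0 !mxE. Qed.

Lemma det_mx2 (a b c e : R) : \det (mx2 a b c e) = a * e - b * c.
Proof.
rewrite (expand_det_row _ 0) !big_ord_recl big_ord0 addr0 /cofactor !det_mx11.
by rewrite !mxE /= expr0 mul1r expr1 mulN1r mulrN.
Qed.

Section ZMatrices.
Variable d : nat.
Let om := omega R d.

Definition zmxval (A : zmx) : 'M[R]_2 :=
  mx2 (zval om (za A)) (zval om (zb A)) (zval om (zc A)) (zval om (ze A)).

Arguments zmxval : simpl never.
Arguments zmxmul : simpl never.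
Arguments zmxexp : simpl never.

Lemma zmxvalM A B : zmxval (zmxmul d A B) = zmxval A * zmxval B.
Proof.
by rewrite mx2_mul /zmxval /= !zvalD !zvalM //; exact: omega_root.
Qed.

Lemma zmxvalN A : zmxval (zmxopp A) = - zmxval A.
Proof. by rewrite mx2N /zmxval /= !zvalN. Qed.

Lemma zmxvalX A n : zmxval (zmxexp d A n) = zmxval A ^+ n.
Proof.
elim: n => [|n IH]; last by rewrite exprS -IH -zmxvalM.
by rewrite expr0 /zmxexp /= /zmxval /= !zval_int mx2_1.
Qed.

Definition zmxvalE := (zval_int, zvalN, mulr0z, mulr1z).

Lemma branches_IE l m ll lm :
  zval om ll = lambda R l -> zval om lm = lambda R m ->
  branches_I R l m = map zmxval (zbranches_I d l m ll lm).
Proof.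
move=> hl hm; rewrite /branches_I /zbranches_I map_allpairs.
apply: eq_allpairs => i j.
by case: ifP => _; rewrite !zmxvalM ?zmxvalX /zmxval /= !zmxvalE hl hm.
Qed.

Lemma branches_IIE l (beta : zq) :
  branches_II l (zval om beta) = map zmxval (zbranches_II d l beta).
Proof.
rewrite /branches_II /zbranches_II map_cat map_flatten -map_comp.
congr (flatten _ ++ _).
  by apply: eq_map => q; rewrite /= !zmxvalM !zmxvalX !zmxvalM /zmxval /= !zmxvalE exprS.
by rewrite /= !zmxvalM !zmxvalX !zmxvalM /zmxval /= !zmxvalE.
Qed.

Lemma branches_IIIE m (alpha beta gamma delta : zq) :
  branches_III m (zval om alpha) (zval om beta) (zval om gamma) (zval om delta)
  = map zmxval (zbranches_III d m alpha beta gamma delta).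
Proof.
rewrite /branches_III /zbranches_III map_flatten -map_comp.
congr flatten; apply: eq_map => j /=.
by case: (odd j); rewrite /= !zmxvalM !zmxvalX !zmxvalM /zmxval /= !zmxvalE.
Qed.

End ZMatrices.

(** * Closed forms of [2 cos(pi/k)] *)

Lemma cos_pi_div_gt0 (k : nat) : (2 < k)%N -> 0 < cos (pi / k%:R : R).
Proof.
move=> k2; apply: cos_gt0_pihalf.
have p0 := @pi_gt0 R; apply/andP; split.
  apply: lt_trans (_ : 0 < _); first by rewrite oppr_lt0 divr_gt0.
  by rewrite divr_gt0 // ltr0n; apply: ltn_trans k2.
by rewrite ltr_pM2l // ltf_pV2 ?posrE ?ltr0n ?ltr_nat //; apply: ltn_trans k2.
Qed.

Lemma lambda2 : lambda R 2 = 0.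
Proof. by rewrite /lambda cos_pihalf mulr0. Qed.

(** For [c = cos(pi/3)], the identity [cos(2 pi/3) = - c] reads [(2c - 1)(c + 1) = 0], and
    [c > 0]. *)
Lemma lambda3 : lambda R 3 = 1.
Proof.
rewrite /lambda; have c0 := @cos_pi_div_gt0 3 isT.
have : cos ((pi / 3 : R) *+ 2) = - cos (pi / 3).
  have -> : (pi / 3 : R) *+ 2 = - (pi / 3) + pi by lra.
  by rewrite cosDpi cosN.
rewrite cos_mulr2n; set c := cos _ in c0 * => h.
have : (2 * c - 1) * (c + 1) = 0 by rewrite -mulr_natr in h; lra.
by move/eqP; rewrite mulf_eq0 => /orP[] /eqP; lra.
Qed.

Lemma sqrtr_eq (x y : R) : 0 <= y -> y * y = x -> Num.sqrt x = y.
Proof. by move=> y0 <-; rewrite -expr2 sqrtr_sqr ger0_norm. Qed.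

Lemma lambda4 : lambda R 4 = Num.sqrt 2.
Proof.
rewrite /lambda; have c0 := @cos_pi_div_gt0 4 isT.
have : cos ((pi / 4 : R) *+ 2) = 0.
  by rewrite -[RHS]cos_pihalf; congr (cos _); lra.
rewrite cos_mulr2n expr2; set c := cos _ in c0 * => h.
by apply/esym/sqrtr_eq; lra.
Qed.

Lemma lambda6 : lambda R 6 = Num.sqrt 3.
Proof.
rewrite /lambda; have c0 := @cos_pi_div_gt0 6 isT.
have : cos ((pi / 6 : R) *+ 2) = cos (pi / 3) by congr (cos _); lra.
rewrite cos_mulr2n expr2; have := lambda3; rewrite /lambda.
set c := cos _ in c0 *; set c3 := cos _ => h3 h.
by apply/esym/sqrtr_eq; lra.
Qed.

(** The identity [cos(4 pi/5) = - cos(pi/5)] is a quartic equation in [c = cos(pi/5)]. Its roots -1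
    and 1/2 are excluded by the positivity of [c] and of [cos(2 pi/5)]; the remaining factor is
    [4c^2 - 2c - 1]. *)
Lemma lambda5 : lambda R 5 = tau R.
Proof.
rewrite /lambda; have c0 := @cos_pi_div_gt0 5 isT.
have c20 : 0 < cos ((pi / 5 : R) *+ 2).
  have p0 := @pi_gt0 R.
  by apply: cos_gt0_pihalf; apply/andP; split; lra.
have : cos ((pi / 5 : R) *+ 2 *+ 2) = - cos (pi / 5).
  have -> : (pi / 5 : R) *+ 2 *+ 2 = - (pi / 5) + pi by lra.
  by rewrite cosDpi cosN.
rewrite [in LHS]cos_mulr2n.
move: c20; rewrite cos_mulr2n !expr2; set c := cos _ in c0 * => h1 h2.
have : (c + 1) * (2 * c - 1) * (4 * (c * c) - 2 * c - 1) = 0 by lra.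
move/eqP; rewrite !mulf_eq0 -orbA => /or3P[] /eqP h; [lra| |].
  by have e : c = 1 / 2 by [lra]; move: h1; rewrite e; lra.
suff : Num.sqrt 5 = 4 * c - 1 by rewrite /tau => ->; lra.
by apply: sqrtr_eq; [nra|lra].
Qed.

(** With this identity every question about the real branches passes to the exact lists. *)
Lemma branchesE t :
  branches R t = map (zmxval (radicand t)) (zbranches t).
Proof.
have hr d : d != 5%N -> omega R d = Num.sqrt d%:R by rewrite /omega => /negbTE->.
have h5 : omega R 5 = tau R by [].
case: t; rewrite /branches /zbranches [radicand _]/=.
- by apply: branches_IE; rewrite ?lambda2 ?lambda5 ?zval_int // /zval /= h5; ring.
- by apply: branches_IE; rewrite ?lambda3 ?lambda4 ?zval_int // /zval /= hr //; ring.
- by apply: branches_IE; rewrite ?lambda3 ?lambda5 ?zval_int // /zval /= h5; ring.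
- by apply: branches_IE; rewrite ?lambda3 ?lambda6 ?zval_int // /zval /= hr //; ring.
- by rewrite -branches_IIE /zval /= hr // mul1r.
- by rewrite -branches_IIE /zval /= h5 mul1r.
- by rewrite -branches_IIE /zval /= hr // mul1r.
- rewrite -branches_IIIE /zval /= hr //.
  by congr branches_III; ring.
- rewrite -branches_IIIE /zval /= hr //.
  by congr branches_III; ring.
Qed.

End Matrices.

(** * Homogeneous coordinates *)

Section Projective.
Variable R : realType.

(** The point with homogeneous coordinates (p : q). The meaningless pair (0 : 0) also goes to oo,
    hence the nonvanishing hypotheses in what follows. *)
Definition proj (p q : R) : P1 R := if q == 0 then None else Some (p / q).

Lemma proj_scale (k p q : R) : k != 0 -> proj (k * p) (k * q) = proj p q.
Proof.
move=> k0; rewrite /proj mulf_eq0 (negbTE k0) /=; case: eqP => // q0.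
by congr Some; rewrite invfM mulrACA divff // mul1r.
Qed.

Lemma I0_proj (z : P1 R) :
  I0 z -> exists r s, [/\ 0 <= r, 0 <= s, (r != 0) || (s != 0) & z = proj r s].
Proof.
case: z => [y|] /= h.
  by exists y, 1; rewrite oner_eq0 orbT /proj oner_eq0 divr1.
by exists 1, 0; rewrite oner_eq0 /proj eqxx.
Qed.

Lemma proj_I0 (p q : R) : 0 <= p -> 0 <= q -> I0 (proj p q).
Proof. by move=> p0 q0; rewrite /proj; case: eqP => //= _; rewrite divr_ge0. Qed.

Lemma proj_eq (p q r s : R) :
  0 <= p -> 0 <= q -> (p != 0) || (q != 0) ->
  0 <= r -> 0 <= s -> (r != 0) || (s != 0) -> proj p q = proj r s ->
  exists2 k, k != 0 & p = k * r /\ q = k * s.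
Proof.
move=> p0 q0 pq r0 s0 rs; rewrite /proj.
have [qz|qn] := eqVneq q 0; have [sz|sn] := eqVneq s 0 => //.
  move: pq rs; rewrite qz sz eqxx !orbF => pn rn _.
  by exists (p / r); rewrite ?mulf_neq0 ?invr_eq0 // mulr0 divfK.
case=> e; exists (q / s); first by rewrite mulf_neq0 ?invr_eq0.
by rewrite divfK //; split => //; rewrite -mulrA [_ * r]mulrC -e mulrC divfK.
Qed.

Lemma mobius_proj (A : 'M[R]_2) (p q : R) : (p != 0) || (q != 0) ->
  mobius A (proj p q) = proj (A 0 0 * p + A 0 1 * q) (A 1 0 * p + A 1 1 * q).
Proof.
rewrite /proj /mobius; have [->|q0 _] := eqVneq q 0.
  rewrite orbF => p0; rewrite !mulr0 !addr0 mulf_eq0 (negbTE p0) orbF.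
  by case: eqP => // c0; rewrite -mulf_div divff // mulr1.
have e u v : u * (p / q) + v = (u * p + v * q) / q :> R by field.
rewrite !e mulf_eq0 invr_eq0 (negbTE q0) orbF; case: eqP => // c0.
by congr Some; rewrite invf_div mulrA divfK.
Qed.

Lemma mobiusN (A : 'M[R]_2) x : mobius (- A) x = mobius A x.
Proof.
case: x => [y|] /=; rewrite !mxE.
  by rewrite !mulNr -!opprD oppr_eq0 invrN mulrNN.
by rewrite oppr_eq0 invrN mulrNN.
Qed.

(** Computed on homogeneous coordinates: [A] keeps a nonzero vector nonzero, because [A^-1] recovers
    it. *)
Lemma mobiusVK (A : 'M[R]_2) z :
  A \is a GRing.unit -> mobius A^-1 (mobius A z) = z.
Proof.
move=> /mulVr AV.
have [r [s [rs ->]]] : exists r s, (r != 0) || (s != 0) /\ z = proj r s.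
  case: z => [y|]; first by exists y, 1; rewrite oner_eq0 orbT /proj oner_eq0 divr1.
  by exists 1, 0; rewrite oner_eq0 /proj eqxx.
have E i j := congr1 (fun M : 'M[R]_2 => M i j) AV.
have := (E 0 0, E 0 1, E 1 0, E 1 1).
rewrite !mxE !big_ord_recl !big_ord0 !addr0 /= => -[[[]]].
have -> : lift 0 0 = 1 :> 'I_2 by apply/val_inj.
set B := A^-1 => e00 e01 e10 e11.
have er : B 0 0 * (A 0 0 * r + A 0 1 * s) + B 0 1 * (A 1 0 * r + A 1 1 * s) = r.
  transitivity ((B 0 0 * A 0 0 + B 0 1 * A 1 0) * r
                + (B 0 0 * A 0 1 + B 0 1 * A 1 1) * s); first by ring.
  by rewrite e00 e01 mul1r mul0r addr0.
have es : B 1 0 * (A 0 0 * r + A 0 1 * s) + B 1 1 * (A 1 0 * r + A 1 1 * s) = s.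
  transitivity ((B 1 0 * A 0 0 + B 1 1 * A 1 0) * r
                + (B 1 0 * A 0 1 + B 1 1 * A 1 1) * s); first by ring.
  by rewrite e10 e11 mul1r mul0r add0r.
rewrite !mobius_proj ?er ?es //.
apply: contraLR rs; rewrite !negb_or !negbK => /andP[/eqP z1 /eqP z2].
by move: er es; rewrite z1 z2 !mulr0 addr0 => <- <-; rewrite eqxx.
Qed.

(** Primes mark conjugates; [(p, q)] is the old vector and [(p1, q1)] the new one. Expand [p], [q]
    through the matrix and bound [p1'], [q1'] through its inverse. The decrease is then at least the
    sum of the gaps in the four inequalities, each with a positive coefficient, so a single strict
    one suffices. *)
Lemma contraction_lt (a b c e a' b' c' e' s s' p q p' q' p1 q1 p1' q1' : R) :
  0 < s -> 0 < s' -> 0 < p1 -> 0 < q1 -> p' != 0 -> q' != 0 ->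
  `|a'| <= a -> `|e'| <= e -> s * `|b'| <= s' * b -> s' * `|c'| <= s * c ->
  [|| `|a'| < a, `|e'| < e, s * `|b'| < s' * b | s' * `|c'| < s * c] ->
  p = a * p1 + b * q1 -> q = c * p1 + e * q1 ->
  `|p1'| = `|e' * p' - b' * q'| -> `|q1'| = `|a' * q' - c' * p'| ->
  s' * `|q1'| * p1 + s * `|p1'| * q1 < s' * `|q'| * p + s * `|p'| * q.
Proof.
move=> s0 s'0 p10 q10; rewrite -!normr_gt0 => p'0 q'0 ha he hb hc strict -> ->.
move=> ep eq.
have := ler_normB (e' * p') (b' * q'); rewrite -ep !normrM.
have := ler_normB (a' * q') (c' * p'); rewrite -eq !normrM => {ep eq}.
move: `|a'| `|b'| `|c'| `|e'| `|p'| `|q'| `|p1'| `|q1'| ha he hb hc strict p'0 q'0.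
move=> A B C E P Q P1 Q1 ha he hb hc strict P0 Q0 hQ1 hP1.
have k1 : 0 < s' * p1 by rewrite mulr_gt0.
have k2 : 0 < s * q1 by rewrite mulr_gt0.
have f1 : s' * p1 * Q1 <= s' * p1 * (A * Q + C * P) by rewrite ler_pM2l.
have f2 : s * q1 * P1 <= s * q1 * (E * P + B * Q) by rewrite ler_pM2l.
have m1 : 0 < s' * p1 * Q by rewrite mulr_gt0.
have m2 : 0 < s * q1 * P by rewrite mulr_gt0.
have m3 : 0 < q1 * Q by rewrite mulr_gt0.
have m4 : 0 < p1 * P by rewrite mulr_gt0.
have g1 : 0 <= s' * p1 * Q * (a - A) by rewrite mulr_ge0 ?subr_ge0 // ltW.
have g2 : 0 <= s * q1 * P * (e - E) by rewrite mulr_ge0 ?subr_ge0 // ltW.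
have g3 : 0 <= q1 * Q * (s' * b - s * B) by rewrite mulr_ge0 ?subr_ge0 // ltW.
have g4 : 0 <= p1 * P * (s * c - s' * C) by rewrite mulr_ge0 ?subr_ge0 // ltW.
have : 0 < s' * p1 * Q * (a - A) + s * q1 * P * (e - E)
           + q1 * Q * (s' * b - s * B) + p1 * P * (s * c - s' * C).
  case/or4P: strict => h.
  - have : 0 < s' * p1 * Q * (a - A) by rewrite mulr_gt0 ?subr_gt0.
    lra.
  - have : 0 < s * q1 * P * (e - E) by rewrite mulr_gt0 ?subr_gt0.
    lra.
  - have : 0 < q1 * Q * (s' * b - s * B) by rewrite mulr_gt0 ?subr_gt0.
    lra.
  - have : 0 < p1 * P * (s * c - s' * C) by rewrite mulr_gt0 ?subr_gt0.
    lra.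
lra.
Qed.

End Projective.

(** * The orbit of a point of K *)

Section Dynamics.
Variables (R : realType) (t : algorithm).
Let d := radicand t.
Let om := omega R d.
Let omc := omega_conj R d.
Let dP : d \in [:: 2; 3; 5; 6]%N := radicandP t.

Lemma nbranchesP M : M \in nbranches t ->
  exists2 A, A \in branches R t & A = zmxval R d M \/ A = - zmxval R d M.
Proof.
case/mapP => N hN ->; exists (zmxval R d N).
  by rewrite branchesE; apply: map_f.
by rewrite /znormal; case: ifP => _; [left|right; rewrite zmxvalN opprK].
Qed.

Lemma branchesP A : A \in branches R t ->
  exists2 M, M \in nbranches t & A = zmxval R d M \/ A = - zmxval R d M.
Proof.
rewrite branchesE => /mapP[N hN ->]; exists (znormal d N); first exact: map_f.
by rewrite /znormal; case: ifP => _; [left|right; rewrite zmxvalN opprK].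
Qed.

(* [(zfst M p q, zsnd M p q)] is [M^-1 (p, q)], as [det M] is 1 or -1. *)
Definition zfst (M : zmx) (p q : zq) : zq :=
  zmul d (zdet d M) (zadd (zmul d (ze M) p) (zopp (zmul d (zb M) q))).
Definition zsnd (M : zmx) (p q : zq) : zq :=
  zmul d (zdet d M) (zadd (zmul d (za M) q) (zopp (zmul d (zc M) p))).

Lemma zval_det (w : R) M : zroot d w ->
  zval w (zdet d M) = zval w (za M) * zval w (ze M) - zval w (zb M) * zval w (zc M).
Proof. by move=> h; rewrite zvalD zvalN !zvalM. Qed.

Lemma det_sign (w : R) M : admissible t M ->
  zval w (zdet d M) = 1 \/ zval w (zdet d M) = -1.
Proof.
case: M => a b c e /and5P[_ _ _ _ /and4P[/orP[] /eqP h _ _ _]]; rewrite h zval_int.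
  by left.
by right.
Qed.

Lemma zfstE (w : R) M p q : zroot d w -> zval w (zfst M p q) =
  zval w (zdet d M) * (zval w (ze M) * zval w p - zval w (zb M) * zval w q).
Proof. by move=> h; rewrite zvalM // zvalD zvalN !zvalM. Qed.

Lemma zsndE (w : R) M p q : zroot d w -> zval w (zsnd M p q) =
  zval w (zdet d M) * (zval w (za M) * zval w q - zval w (zc M) * zval w p).
Proof. by move=> h; rewrite zvalM // zvalD zvalN !zvalM. Qed.

Lemma zinv_fst (w : R) M p q : zroot d w -> admissible t M ->
  zval w p = zval w (za M) * zval w (zfst M p q)
             + zval w (zb M) * zval w (zsnd M p q).
Proof.
move=> h ad; rewrite zfstE // zsndE //; have := zval_det M h.
set D := zval w (zdet d M) => eD.
have D2 : D * D = 1 by rewrite /D; case: (det_sign w ad) => ->; ring.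
by rewrite -[LHS]mul1r -D2 {2}eD; ring.
Qed.

Lemma zinv_snd (w : R) M p q : zroot d w -> admissible t M ->
  zval w q = zval w (zc M) * zval w (zfst M p q)
             + zval w (ze M) * zval w (zsnd M p q).
Proof.
move=> h ad; rewrite zfstE // zsndE //; have := zval_det M h.
set D := zval w (zdet d M) => eD.
have D2 : D * D = 1 by rewrite /D; case: (det_sign w ad) => ->; ring.
by rewrite -[LHS]mul1r -D2 {2}eD; ring.
Qed.

(** The two inequalities say low end <= p/q <= high end, cross-multiplied. Walk up the chain: a
    point above the current low end either lies below the high end or is above the next low end, and
    the last high end is oo. *)
Lemma tiling_cover (As : seq zmx) (p q : R) :
  tiling d As -> 0 <= p -> 0 <= q ->
  exists2 M, M \in As &
    0 <= p * zval om (low_end d M).2 - q * zval om (low_end d M).1 /\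
    0 <= q * zval om (high_end d M).1 - p * zval om (high_end d M).2.
Proof.
move=> + p0 q0; case: As => [//|A As] /and3P[/eqP hlow hpath /eqP hhigh].
have {}hlow : 0 <= p * zval om (low_end d A).2 - q * zval om (low_end d A).1.
  by rewrite hlow /= !zval_int; lra.
elim: As A hlow hpath hhigh => [|B As IH] A hlow /=.
  move=> _ hhigh; exists A; rewrite ?inE //; split => //.
  by rewrite hhigh /= !zval_int; lra.
case/andP => /eqP hAB hpath hlast.
have [h|h] := lerP 0 (q * zval om (high_end d A).1 - p * zval om (high_end d A).2).
  by exists A; rewrite ?inE ?eqxx.
have [|M hM hh] := IH B _ hpath hlast; first by rewrite -hAB; lra.
by exists M => //; rewrite inE hM orbT.
Qed.

(** The cross products of [tiling_cover] are the coordinates of [M^-1 (p, q)]; the sign of the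
    determinant decides which endpoint yields which coordinate. *)
Lemma nbranches_cover (p q : zq) :
  0 <= zval om p -> 0 <= zval om q ->
  exists2 M, M \in nbranches t &
    0 <= zval om (zfst M p q) /\ 0 <= zval om (zsnd M p q).
Proof.
move=> p0 q0; have [M hM] := tiling_cover (nbranches_tiling t) p0 q0.
have ad := allP (nbranches_admissible t) _ hM.
rewrite /low_end /high_end => h; exists M => //.
rewrite zfstE ?zsndE; try exact: omega_root.
have : zdet d M = zint 1 \/ zdet d M = zint (-1).
  move: ad; case: (M) => a b c e.
  by case/and5P=> _ _ _ _ /and4P[/orP[] /eqP -> _ _ _]; [left|right].
by case=> e; move: h; rewrite e /= !zval_int /=; case=> h1 h2; split; lra.
Qed.

Lemma zmxval_unit M : admissible t M -> zmxval R d M \is a GRing.unit.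
Proof.
move=> ad; suff : zmxval R d M \in unitmx by [].
rewrite unitmxE det_mx2 -zval_det.
  by case: (det_sign om ad) => ->; rewrite ?unitrN unitr1.
exact: omega_root.
Qed.

Lemma zval_nz (p q : zq) : (p, q) != (zint 0, zint 0) ->
  (zval om p != 0) || (zval om q != 0).
Proof. by rewrite !zval_eq0 // xpair_eqE negb_and. Qed.

Lemma mobius_branch M (A : 'M[R]_2) (r s : R) :
  A = zmxval R d M \/ A = - zmxval R d M -> (r != 0) || (s != 0) ->
  mobius A (proj r s) = proj (zval om (za M) * r + zval om (zb M) * s)
                             (zval om (zc M) * r + zval om (ze M) * s).
Proof.
move=> hA rs; have -> : mobius A (proj r s) = mobius (zmxval R d M) (proj r s).
  by case: hA => -> //; rewrite mobiusN.
by rewrite mobius_proj // !mxE.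
Qed.

(** Lifts one step of [T] to integral vectors. It is enough that some branch realises the step, so
    the choice made at a common endpoint does not matter. *)
Lemma T_proj (p q : zq) :
  0 <= zval om p -> 0 <= zval om q -> (p, q) != (zint 0, zint 0) ->
  exists2 M, M \in nbranches t &
    [/\ 0 <= zval om (zfst M p q), 0 <= zval om (zsnd M p q) &
        T t (proj (zval om p) (zval om q)) =
        proj (zval om (zfst M p q)) (zval om (zsnd M p q))].
Proof.
move=> p0 q0 /zval_nz pq; pose x := proj (zval om p) (zval om q).
have om_root : zroot d om by exact: omega_root.
have nzinv M : admissible t M ->
    (zval om (zfst M p q) != 0) || (zval om (zsnd M p q) != 0).
  move=> ad; apply: contraLR pq; rewrite !negb_or !negbK => /andP[/eqP h1 /eqP h2].
  by rewrite (zinv_fst p q om_root ad) (zinv_snd p q om_root ad) h1 h2 !mulr0 addr0 eqxx.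
(* The intervals cover the point, so [find] succeeds and the default 1 of [nth] is not reached. *)
have hx : has (fun A => x \in mobius A @` I0) (branches R t).
  have [M hM [h1 h2]] := nbranches_cover p0 q0.
  have ad := allP (nbranches_admissible t) _ hM.
  have [A hA eA] := nbranchesP hM; apply/hasP; exists A => //.
  rewrite inE; exists (proj (zval om (zfst M p q)) (zval om (zsnd M p q))).
    exact: proj_I0.
  by rewrite (mobius_branch eA (nzinv M ad)) -zinv_fst // -zinv_snd.
rewrite -/x /T; set A := nth _ _ _.
have hA : A \in branches R t by rewrite mem_nth // -has_find.
have := nth_find 1 hx; rewrite -/A /= inE => -[z /I0_proj[r [s [r0 s0 rs ->]]] hz].
have [M hM eA] := branchesP hA.
have ad := allP (nbranches_admissible t) _ hM.
have uA : A \is a GRing.unit.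
  by case: eA => ->; rewrite ?unitrN zmxval_unit.
exists M => //; rewrite -hz mobiusVK //.
have [a0 b0 c0 e0] : [/\ 0 <= zval om (za M), 0 <= zval om (zb M),
    0 <= zval om (zc M) & 0 <= zval om (ze M)].
  move: ad; case: (M) => a b c e /and5P[/zge0P ha /zge0P hb /zge0P hc /zgt0P he _].
  by split; rewrite ?ha ?hb ?hc ?ltW ?he.
move: hz; rewrite (mobius_branch eA rs) => hz.
have nz : (zval om (za M) * r + zval om (zb M) * s != 0)
       || (zval om (zc M) * r + zval om (ze M) * s != 0).
  apply: contraLR rs; rewrite !negb_or !negbK => /andP[/eqP h1 /eqP h2].
  have eD := zval_det M om_root.
  have D0 : zval om (zdet d M) != 0.
    by case: (det_sign om ad) => ->; rewrite ?oppr_eq0 oner_eq0.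
  have h3 : zval om (zdet d M) * r = 0.
    rewrite eD; transitivity (zval om (ze M) * (zval om (za M) * r + zval om (zb M) * s)
      - zval om (zb M) * (zval om (zc M) * r + zval om (ze M) * s)); first by ring.
    by rewrite h1 h2 !mulr0 subr0.
  have h4 : zval om (zdet d M) * s = 0.
    rewrite eD; transitivity (zval om (za M) * (zval om (zc M) * r + zval om (ze M) * s)
      - zval om (zc M) * (zval om (za M) * r + zval om (zb M) * s)); first by ring.
    by rewrite h1 h2 !mulr0 subr0.
  by move/eqP: h3; move/eqP: h4; rewrite !mulf_eq0 (negbTE D0) /= => -> ->.
(* A priori the preimage has only real coordinates [(r, s)]; they are proportional to the integral
   vector [M^-1 (p, q)], with factor [k]. *)
have [||k k0 [hp hq]] := proj_eq p0 q0 pq _ _ nz (esym hz).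
- by rewrite addr_ge0 ?mulr_ge0.
- by rewrite addr_ge0 ?mulr_ge0.
have D2 : zval om (zdet d M) * zval om (zdet d M) = 1.
  by case: (det_sign om ad) => ->; ring.
have er : zval om (zfst M p q) = k * r.
  rewrite zfstE // hp hq -[RHS]mul1r -D2 {3}zval_det //; ring.
have es : zval om (zsnd M p q) = k * s.
  rewrite zsndE // hp hq -[RHS]mul1r -D2 {3}zval_det //; ring.
(* A negative factor would make [p] and [q] nonpositive, hence both zero. *)
have kp : 0 < k.
  rewrite lt_neqAle eq_sym k0 /= leNgt; apply/negP => kn.
  case/orP: pq => /negP; apply; rewrite eq_le.
    by rewrite p0 hp andbT nmulr_rle0 ?addr_ge0 ?mulr_ge0.
  by rewrite q0 hq andbT nmulr_rle0 ?addr_ge0 ?mulr_ge0.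
by rewrite er es proj_scale //; split => //; rewrite mulr_ge0 // ltW.
Qed.

(** * The height and its strict decrease *)

Definition height (p q : zq) : R :=
  let x := zmul d p (zconj d (zmul d (weight t) q)) in
  `|zval om x| + `|zval omc x|.

Lemma abs_conj_weightE : zval om (abs_conj_weight t) = `|zval omc (weight t)|.
Proof.
have := zgt0P R dP (abs_conj_weight_gt0 t).
rewrite /om /omc /abs_conj_weight; case: ifP => _; rewrite ?zvalN zval_conj => h.
  by rewrite gtr0_norm.
by rewrite -normrN gtr0_norm.
Qed.

(** Multiplicativity of both embeddings turns [|h| + |h'|], whose square is a natural number, into
    the weighted sum to which [contraction_lt] applies. *)
Lemma heightE p q : 0 <= zval om p -> 0 <= zval om q ->
  height p q = zval om (abs_conj_weight t) * `|zval omc q| * zval om p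
               + zval om (weight t) * `|zval omc p| * zval om q.
Proof.
move=> p0 q0; rewrite /height abs_conj_weightE.
have s0 := zgt0P R dP (weight_gt0 t).
have hr : zroot d om := omega_root R d; have hc : zroot d omc := omega_conj_root R d.
rewrite !zvalM // zval_conj zval_conjK !zvalM // !normrM.
by rewrite (ger0_norm p0) (ger0_norm q0) (gtr0_norm s0); ring.
Qed.

Definition contraction_hyps (M : zmx) : Prop :=
  let s := zval om (weight t) in let s' := zval om (abs_conj_weight t) in
  let: ZMx a b c e := M in
  [/\ `|zval omc a| <= zval om a, `|zval omc e| <= zval om e,
      s * `|zval omc b| <= s' * zval om b, s' * `|zval omc c| <= s * zval om c
    & [|| `|zval omc a| < zval om a, `|zval omc e| < zval om e,
          s * `|zval omc b| < s' * zval om b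
        | s' * `|zval omc c| < s * zval om c]].

Lemma admissible_contraction M : admissible t M -> contraction_hyps M.
Proof.
have hr : zroot d om := omega_root R d.
have s0 := zgt0P R dP (weight_gt0 t).
have s'0 := zgt0P R dP (abs_conj_weight_gt0 t).
case: M => a b c e /and5P[_ _ _ _ /and4P[_ _ _ /and5P[]]].
move=> /(zabs_leP R dP) + /(zabs_leP R dP) + /(zabs_leP R dP) + /(zabs_leP R dP).
rewrite !zvalM // !zval_conj !normrM (gtr0_norm s0) (gtr0_norm s'0).
move=> ha he hb hc strict; split => //; apply/or4P.
case/or4P: strict => /(zabs_ltP R dP).
- by rewrite zval_conj => h; apply: Or41.
- by rewrite zval_conj => h; apply: Or42.
- by rewrite !zvalM // zval_conj normrM (gtr0_norm s0) => h; apply: Or43.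
- by rewrite !zvalM // zval_conj normrM (gtr0_norm s'0) => h; apply: Or44.
Qed.

Lemma height_lt M p q : admissible t M ->
  0 <= zval om p -> 0 <= zval om q -> p != zint 0 -> q != zint 0 ->
  0 < zval om (zfst M p q) -> 0 < zval om (zsnd M p q) ->
  height (zfst M p q) (zsnd M p q) < height p q.
Proof.
move=> ad p0 q0 pn qn p1 q1.
have hr : zroot d om := omega_root R d; have hc : zroot d omc := omega_conj_root R d.
rewrite !heightE ?(ltW p1) ?(ltW q1) //.
have s0 := zgt0P R dP (weight_gt0 t).
have s'0 := zgt0P R dP (abs_conj_weight_gt0 t).
(* The factor [det M] in [zfst] and [zsnd] disappears under the absolute values of the
   conjugates. *)
have hD : `|zval omc (zdet d M)| = 1.
  by case: (det_sign omc ad) => ->; rewrite ?normrN normr1.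
have := admissible_contraction ad; case: M ad p1 q1 hD => a b c e ad p1 q1 hD.
case=> ha he hb hc' strict.
apply: (contraction_lt s0 s'0 p1 q1 _ _ ha he hb hc' strict).
- by rewrite zval_conj_eq0.
- by rewrite zval_conj_eq0.
- exact: (zinv_fst p q hr ad).
- exact: (zinv_snd p q hr ad).
- by rewrite zfstE // normrM hD mul1r.
- by rewrite zsndE // normrM hD mul1r.
Qed.

(** Induction on a strict bound for the squared height. If a coordinate of the current or of the
    next vector vanishes, the orbit is at 0 or oo; otherwise [height_lt] lowers the bound. *)
Lemma orbit_reaches_cusp (n : nat) (p q : zq) :
  0 <= zval om p -> 0 <= zval om q -> (p, q) != (zint 0, zint 0) ->
  height p q ^+ 2 < n%:R ->
  exists k, let x := iter k (T t) (proj (zval om p) (zval om q)) in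
    x = None \/ x = Some 0.
Proof.
elim: n p q => [|n IH] p q p0 q0 pq hn.
  by move: hn; rewrite ltNge sqr_ge0.
have [p_z|pn] := eqVneq p (zint 0).
  exists 0%N => /=; right; rewrite /proj p_z zval_int mul0r.
  by move: pq; rewrite p_z xpair_eqE eqxx /= -(zval_eq0 R dP) => /negbTE ->.
have [q_z|qn] := eqVneq q (zint 0).
  by exists 0%N => /=; left; rewrite /proj q_z zval_int eqxx.
have [M hM [p10 q10 hT]] := T_proj p0 q0 pq.
have ad := allP (nbranches_admissible t) _ hM.
have [p1_z|p1n] := eqVneq (zval om (zfst M p q)) 0.
  exists 1%N; rewrite /= hT p1_z /proj mul0r; case: eqP; by [left|right].
have [q1_z|q1n] := eqVneq (zval om (zsnd M p q)) 0.
  by exists 1%N; left; rewrite /= hT q1_z /proj eqxx.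
have [||||k hk] := IH (zfst M p q) (zsnd M p q) => //.
- by rewrite xpair_eqE negb_and -(zval_eq0 R dP) p1n.
- have lt1 : height (zfst M p q) (zsnd M p q) ^+ 2 < height p q ^+ 2.
    rewrite ltr_sqr ?nnegrE ?addr_ge0 //; apply: height_lt => //.
      by rewrite lt_neqAle eq_sym p1n.
    by rewrite lt_neqAle eq_sym q1n.
  move: lt1 hn; rewrite /height.
  have [m1 ->] := zval_height_nat R d
    (zmul d (zfst M p q) (zconj d (zmul d (weight t) (zsnd M p q)))).
  have [m ->] := zval_height_nat R d (zmul d p (zconj d (zmul d (weight t) q))).
  by rewrite !ltr_nat ltnS => h1 h2; apply: leq_trans h2.
by exists k.+1; rewrite iterSr hT.
Qed.

(** * Parabolic elements fixing 0 and oo *)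

Lemma nbranches_Gamma_pm M : M \in nbranches t -> Gamma_pm t (zmxval R d M).
Proof.
move=> hM; have [A hA [] e] := nbranchesP hM.
  by rewrite -e; apply: Gamma_pm_gen.
by rewrite -[zmxval _ _ _]opprK -e; apply/Gamma_pm_N/Gamma_pm_gen.
Qed.

(** Asking for [b c = 0] and [b + c] nonzero treats upper and lower unipotent matrices together. *)
Lemma unipotent_parabolic M : M \in nbranches t ->
  za M = zint 1 -> ze M = zint 1 ->
  zval om (zb M) * zval om (zc M) = 0 -> zval om (zb M) + zval om (zc M) != 0 ->
  Gamma t (zmxval R d M) /\ parabolic (zmxval R d M).
Proof.
move=> hM ha he hbc nz; split.
  split; first exact: nbranches_Gamma_pm.
  by rewrite det_mx2 ha he hbc zval_int; ring.
have offdiag (B : 'M[R]_2) : B 0 1 = 0 -> B 1 0 = 0 -> zmxval R d M <> B.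
  move=> b01 b10 e; move: nz b01 b10.
  by rewrite -e !mxE /= => + h1 h2; rewrite h1 h2 addr0 eqxx.
split; [by apply: offdiag; rewrite !mxE| |].
  by apply: offdiag; rewrite !mxE oppr0.
by rewrite tr_mx2 ha he zval_int ger0_norm.
Qed.

(** If [(p, q)] is the image of [(1, 0)] under the inverse branch, then [0 = c p + e q] with
    nonnegative terms and [e > 0]. Hence [q = 0], then [c = 0], and the branch is a translation. *)
Lemma T_infinity :
  T t (None : P1 R) = None /\
  exists A : 'M[R]_2, [/\ Gamma t A, parabolic A & mobius A None = None].
Proof.
have := @T_proj (zint 1) (zint 0); rewrite !zval_int /proj eqxx => /(_ _ _ _)[] //.
move=> M hM [p0 q0 ->].
have ad := allP (nbranches_admissible t) _ hM.
have := zinv_fst (zint 1) (zint 0) (omega_root R d) ad.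
have := zinv_snd (zint 1) (zint 0) (omega_root R d) ad.
move: p0 q0; rewrite !zval_int; set p := zval _ (zfst _ _ _).
set q := zval _ (zsnd _ _ _).
move=> p0 q0 e0 e1.
have [c0 [e_gt0 hc]] : 0 <= zval om (zc M) /\ 0 < zval om (ze M) /\
   (zc M == zint 0 -> [&& za M == zint 1, ze M == zint 1 & zgt0 d (zb M)]).
  move: ad; case: (M) => a b c e.
  case/and5P=> _ _ /(zge0P R dP) h1 /(zgt0P R dP) h2 /and4P[_ _ /implyP h3 _].
  by [].
have qz : q = 0 by nra.
have pn : p != 0.
  by apply/eqP => pz; move: e1; rewrite pz qz !mulr0 addr0 => /eqP; rewrite oner_eq0.
have /eqP : zval om (zc M) * p = 0 by move: e0; rewrite qz mulr0 addr0.
rewrite mulf_eq0 (negbTE pn) orbF zval_eq0 // => cz.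
have /and3P[/eqP ha /eqP he /(zgt0P R dP) hb] := hc cz.
rewrite qz eqxx; split => //; exists (zmxval R d M).
have [||h1 h2] := unipotent_parabolic hM ha he.
- by rewrite (eqP cz) zval_int mulr0.
- by rewrite (eqP cz) zval_int addr0 gt_eqF.
by split => //=; rewrite !mxE /= (eqP cz) zval_int eqxx.
Qed.

(** Now [0 = a p + b q] with nonnegative terms. If [b > 0] then [q = 0] and the image is oo; if
    [b = 0] the branch is lower unipotent and fixes 0. *)
Lemma T_zero :
  T t (Some 0 : P1 R) = None \/
  T t (Some 0 : P1 R) = Some 0 /\
  exists A : 'M[R]_2, [/\ Gamma t A, parabolic A & mobius A (Some 0) = Some 0].
Proof.
have := @T_proj (zint 0) (zint 1).
rewrite !zval_int /proj oner_eq0 mul0r => /(_ _ _ _)[] //.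
move=> M hM [p0 q0 ->].
have ad := allP (nbranches_admissible t) _ hM.
have := zinv_fst (zint 0) (zint 1) (omega_root R d) ad.
have := zinv_snd (zint 0) (zint 1) (omega_root R d) ad.
move: p0 q0; rewrite !zval_int; set p := zval _ (zfst _ _ _).
set q := zval _ (zsnd _ _ _).
move=> p0 q0 e1 e0.
have [a0 [b0 hb]] : 0 <= zval om (za M) /\ 0 <= zval om (zb M) /\
   (zb M == zint 0 -> [&& za M == zint 1, ze M == zint 1 & zgt0 d (zc M)]).
  move: ad; case: (M) => a b c e.
  case/and5P=> /(zge0P R dP) h1 /(zge0P R dP) h2 _ _ /and4P[_ /implyP h3 _ _].
  by [].
have [bz|bn] := eqVneq (zb M) (zint 0); last first.
  have b_gt0 : 0 < zval om (zb M) by rewrite lt_neqAle eq_sym zval_eq0 // bn.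
  by left; have -> : q = 0; [nra|rewrite eqxx].
have /and3P[/eqP ha /eqP he /(zgt0P R dP) hc] :
    [&& za M == zint 1, ze M == zint 1 & zgt0 d (zc M)].
  by apply: hb; rewrite bz.
have pz : p = 0 by move: e0; rewrite ha bz !zval_int; lra.
have q1 : q = 1 by move: e1; rewrite he pz zval_int; lra.
right; rewrite pz q1 oner_eq0 mul0r; split => //; exists (zmxval R d M).
have [||h1 h2] := unipotent_parabolic hM ha he.
- by rewrite bz zval_int mul0r.
- by rewrite bz zval_int add0r gt_eqF.
split => //=; rewrite !mxE /= mulr0 add0r he zval_int oner_eq0.
by rewrite bz zval_int mulr0 addr0 mul0r.
Qed.

Lemma quadratic_field_ratio (y : R) : quadratic_field R d y ->
  exists p q : zq, [/\ q != zint 0, 0 <= zval om q & y = zval om p / zval om q].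
Proof.
case=> a [b ->].
have hr : zroot d om := omega_root R d.
exists (zadd (zint (numq a * denq b)) (zmul d (zint (numq b * denq a)) (zsqrt d))).
exists (zint (denq a * denq b)).
have dn c : (denq c)%:~R != 0 :> R by rewrite intr_eq0 denq_neq0.
rewrite -(zval_eq0 R dP) zvalD zvalM // !zval_int zval_sqrt !intrM; split.
- by rewrite mulf_neq0.
- by rewrite mulr_ge0 // ler0z denq_ge0.
by rewrite /ratr; field; rewrite !dn.
Qed.

End Dynamics.

Unset Implicit Arguments.

Theorem mainTheorem3 (R : realType) (t : algorithm) (alpha : P1 R)
    (alphaK : P1_field (quadratic_field R (radicand t)) alpha)
    (alphaI : I0 alpha) :
  exists n : nat,
    let x := iter n (T t) alpha in
    T t x = x /\
    exists A : 'M[R]_2, [/\ Gamma t A, parabolic A & mobius A x = x].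
Proof.
have rad := radicandP t.
have [k hk] : exists k, let x := iter k (T t) alpha in x = None \/ x = Some 0.
  case: alphaK alphaI => [[y hy <-] /= y0|-> _]; last by exists 0%N; left.
  have [p [q [qn q0 e]]] := quadratic_field_ratio hy.
  have qn' : zval (omega R (radicand t)) q != 0 by rewrite zval_eq0.
  have p0 : 0 <= zval (omega R (radicand t)) p.
    by move: y0; rewrite e pmulr_lge0 // invr_gt0 lt_neqAle eq_sym qn'.
  have [n hn] := zval_height_nat R (radicand t)
    (zmul (radicand t) p (zconj (radicand t) (zmul (radicand t) (weight t) q))).
  (* The squared height equals [n], so [n.+1] is a strict bound. *)
  have [||k] := @orbit_reaches_cusp R t n.+1 p q p0 q0.
  - by rewrite xpair_eqE negb_and qn orbT.
  - by rewrite /height hn ltr_nat.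
  by rewrite /proj (negbTE qn') -e => hk; exists k.
case: hk => hk; first by exists k; rewrite /= hk; apply: T_infinity.
case: (T_zero R t) => [h0|h0]; last by exists k; rewrite /= hk.
(* Here 0 is not fixed, and one further step leads to oo. *)
by exists k.+1; rewrite /= hk h0; apply: T_infinity.
Qed.
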